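(* For every $p\in(0,1)$ there are constants $C,c,T_0>0$ (which may depend on $p$) such that for every $T\ge T_0$, in the hidden bandit model with parameters $p,T$: (a) there is a semi-Markovian player algorithm whose expected regret against every consistent adversary is at most $C\,T/\log T$; (b) for every semi-Markovian player algorithm there is a consistent adversary against which the expected regret of the algorithm is at least $c\,T/\log T$.
   Context: Hidden bandit model with parameters $T$ (number of rounds) and $p\in(0,1)$. There are two arms: arm $0$ (the reference arm) and arm $1$ (the decoy arm). Before round 1 the player is placed at random on arm $0$ with probability $\frac{p}{1+p}$ and on arm $1$ with probability $\frac1{1+p}$. On each round the player chooses one of two actions: ''stay'', which keeps him on the arm on which he entered the round; or ''switch'', which moves him to arm $1$ if he entered the round on arm $0$, and if he entered on arm $1$ moves him to arm $0$ with probability $p$ and leaves him on arm $1$ with probability $1-p$. Let $X_t\in\{0,1\}$ be the arm pulled on round $t$ (the arm the player is on after the action of round $t$). The player does not observe $X_t$; on round $t$ he observes only the reward $r_t(X_t)\in[0,1]$. The expected regret is $\sum_{t=1}^T r_t(0)-\mathbf E[\sum_{t=1}^T r_t(X_t)]$. Consistent adversary: the adversary selects an offset $0<\Delta\le1$ and an arbitrary sequence of rewards $r_t(0)\in[\Delta,1]$, $t=1,\dots,T$, for the reference arm, and sets $r_t(1)=r_t(0)-\Delta$ for every $t$. Semi-Markovian algorithm: the player's decision depends only on the sequence of rewards obtained since the last switch request. Namely, the input is a memory string $s$ that starts with a switch request and continues with the nonempty sequence of rewards observed since that switch up to and including the current round, and the output is a probability $p(s)\in[0,1]$. With probability $p(s)$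 (using fresh randomness) the player requests a switch for the next round, discards $s$, and starts a new memory string beginning with this switch; otherwise he stays and keeps $s$. In either case the reward observed in the next round is appended to the memory string. By convention there is an initial switch in a fictitious round $0$ (with no reward). *)

(* Defs.v *)
From mathcomp Require Import all_boot all_order all_algebra.
From mathcomp Require Import reals exp.

Set Implicit Arguments.
Unset Strict Implicit.
Unset Printing Implicit Defensive.

Import Order.TTheory GRing.Theory Num.Theory.
Local Open Scope ring_scope.

Definition arm0 : bool := false.
Definition arm1 : bool := true.

Section HiddenBandit.
Variable R : realType.
Implicit Types (p : R) (T t : nat) (x y a : bool) (s : seq R).
Implicit Types (q : seq R -> R) (r : nat -> bool -> R).

Definition init_law p x : R := if x == arm0 then p / (1 + p) else 1 / (1 + p).

(* [switch_law p x y]: probability of landing on [y] when switching from [x]. *)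
Definition switch_law p x y : R :=
  if x == arm0 then (y == arm1)%:R else if y == arm0 then p else 1 - p.

(* Actions are booleans, [true] being a switch request. *)
Definition move_law p a x y : R :=
  if a then switch_law p x y else (y == x)%:R.

(* A memory string is the chronological sequence of rewards obtained since    *)
(* the last switch request; the leading request itself is left implicit.      *)
Definition semi_markovian q : Prop :=
  forall s, s != [::] -> 0 <= q s <= 1.

(* The empty string occurs only on entering round 1, where it stands for the  *)
(* fictitious switch of round 0: no decision has been made yet, and round 1   *)
(* is played on the initial arm. Executing that switch on the initial arm     *)
(* would give the same process, by [init_law_stationary].                     *)
Definition action_law q s a : R :=
  let z := if s is [::] then 0 else q s in if a then z else 1 - z.

Definition update_memory s a (rew : R) : seq R :=
  if a then [:: rew] else rcons s rew.

(* Probability that rounds [t], [t+1], ... yield the (action, arm) pairs [w], *)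
(* for a player entering round [t] on arm [x] with memory string [s].         *)
Fixpoint run_law p q r t x s (w : seq (bool * bool)) : R :=
  if w is (a, y) :: w' then
    action_law q s a * move_law p a x y
      * run_law p q r t.+1 y (update_memory s a (r t y)) w'
  else 1.

(* An outcome is the initial arm together with the (action, arm) pairs of     *)
(* rounds 1, ..., T.                                                          *)
Definition outcome T : finType := (bool * T.-tuple (bool * bool))%type.

Definition outcome_law p T q r (w : outcome T) : R :=
  init_law p w.1 * run_law p q r 1 w.1 [::] w.2.

Definition pulled_arm T (w : outcome T) t : bool :=
  nth arm0 (w.1 :: [seq ay.2 | ay <- w.2]) t.

Definition expectation p T q r (f : outcome T -> R) : R :=
  \sum_(w : outcome T) outcome_law p q r w * f w.

Definition expected_regret p T q r : R :=
  \sum_(1 <= t < T.+1) r t arm0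
  - expectation p q r (fun w : outcome T =>
      \sum_(1 <= t < T.+1) r t (pulled_arm w t)).

Definition consistent_adversary T r : Prop :=
  exists2 Delta : R, 0 < Delta <= 1 &
    forall t, (1 <= t <= T)%N ->
      Delta <= r t arm0 <= 1 /\ r t arm1 = r t arm0 - Delta.

Lemma init_law_stationary p y : 0 < p ->
  \sum_x init_law p x * switch_law p x y = init_law p y.
Proof.
move=> p0; have p1 : 1 + p != 0 by rewrite gt_eqF// addr_gt0.
rewrite big_bool /init_law /switch_law; case: y => /=.
  rewrite mulr1 -mulrA [_^-1 * _]mulrC mulrA -mulrDl.
  by congr (_ / _); rewrite mul1r subrK.
by rewrite mulr0 addr0 mulrAC mul1r.
Qed.

End HiddenBandit.

(* Main.v *)
(* The expected regret is Delta times the expected time on arm 1.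

   (a) Switch with probability exp(-K v)/2 after a reward v, with K = (ln T)/2.
   The two arms' rewards differ by Delta, so the rate of leaving arm 1 exceeds
   that of leaving arm 0 by the constant factor rho = p exp(K Delta), whatever
   the rewards are. The stationary mass of arm 1 costs at most
   Delta / (1 + rho) <= 1 / (p K) per round, and the transient at most
   O(exp K) = O(sqrt T) rounds.

   (b) Cut [0, 1] into M ~ log2 T steps and consider the M adversaries paying
   constantly (i+1)/M on arm 0 and i/M on arm 1. If h i is the expected length,
   truncated at the horizon, of a sojourn with constant reward i/M, then
   1 <= h i <= T < 2^M, so h (i+1) <= 2 h i for some i. Each sojourn on arm 0
   after the first follows one on arm 1, so against the i-th adversary arm 1
   takes a constant fraction of the time, at a cost 1/M per round. *)
Require Import Defs.
From mathcomp Require Import all_boot all_order all_algebra.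
From mathcomp Require Import reals sequences exp.
From mathcomp Require Import ring lra.

Import Order.TTheory GRing.Theory Num.Theory.
Local Open Scope ring_scope.

(** * Expected additive payoffs by backward recursion *)

Section Value.
Context {R : realType}.
Variables (p : R) (q : seq R -> R) (r : nat -> bool -> R).

(** Conditioning on the first round turns a sum over outcomes ([valueE]) into a recursion on the
    number [n] of rounds left, so that later estimates are inductions on [n]. *)
Fixpoint value (g : bool -> bool -> R) n t x (s : seq R) : R :=
  if n is n'.+1 then
    \sum_a \sum_y action_law q s a * move_law p a x y *
      (g a y + value g n' t.+1 y (update_memory s a (r t y)))
  else 0.

Lemma sum_action_move s x :
  \sum_a \sum_y action_law q s a * move_law p a x y = 1.
Proof.
by rewrite !big_bool /action_law /move_law /switch_law; case: s x => [|? ?] [] /=; ring.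
Qed.

Lemma big_tuple_cons n (F : seq (bool * bool) -> R) :
  \sum_(w : n.+1.-tuple (bool * bool)) F w =
  \sum_a \sum_y \sum_(w : n.-tuple (bool * bool)) F ((a, y) :: w).
Proof.
rewrite pair_bigA /= pair_bigA /=.
rewrite (reindex (fun u : (bool * bool) * n.-tuple (bool * bool) =>
  [tuple of u.1 :: u.2])) /=.
  by apply: eq_bigr => -[[a y] w].
exists (fun w => (thead w, [tuple of behead w])) => [[ay w] _|w _] /=.
  by congr pair; apply: val_inj.
by rewrite [RHS]tuple_eta.
Qed.

Lemma sum_run_law n t x s :
  \sum_(w : n.-tuple (bool * bool)) run_law p q r t x s w = 1.
Proof.
elim: n t x s => [|n IH] t x s.
  by rewrite (eq_bigr (fun=> 1)) => [|w _]; rewrite ?sumr_const ?card_tuple // tuple0.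
rewrite big_tuple_cons -[RHS](sum_action_move s x).
apply: eq_bigr => a _; apply: eq_bigr => y _ /=.
by rewrite -mulr_sumr IH mulr1.
Qed.

Lemma valueE g n t x s :
  \sum_(w : n.-tuple (bool * bool))
     run_law p q r t x s w * (\sum_(ay <- w) g ay.1 ay.2) = value g n t x s.
Proof.
elim: n t x s => [|n IH] t x s.
  by rewrite big1 // => w _; rewrite tuple0 big_nil mulr0.
rewrite (big_tuple_cons _ (fun w => run_law p q r t x s w *
  (\sum_(ay <- w) g ay.1 ay.2))) /=.
apply: eq_bigr => a _; apply: eq_bigr => y _; rewrite -IH.
rewrite -[g a y]mul1r -(sum_run_law n t.+1 y (update_memory s a (r t y))).
rewrite mulr_suml -big_split /= mulr_sumr; apply: eq_bigr => w _.
by rewrite big_cons /= -mulrA mulrDr.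
Qed.

Lemma value_nil g n t x :
  value g n.+1 t x [::] = g false x + value g n t.+1 x [:: r t x].
Proof.
by rewrite /= !big_bool /action_law /move_law; case: x => /=; ring.
Qed.

Lemma value_arm0 g n t s : s != [::] ->
  value g n.+1 t false s =
    (1 - q s) * (g false false + value g n t.+1 false (rcons s (r t false)))
    + q s * (g true true + value g n t.+1 true [:: r t true]).
Proof.
by case: s => // v s _; rewrite /= !big_bool /action_law /move_law /switch_law /=; ring.
Qed.

Lemma value_arm1 g n t s : s != [::] ->
  value g n.+1 t true s =
    (1 - q s) * (g false true + value g n t.+1 true (rcons s (r t true)))
    + q s * (p * (g true false + value g n t.+1 false [:: r t false])
             + (1 - p) * (g true true + value g n t.+1 true [:: r t true])).
Proof.
by case: s => // v s _; rewrite /= !big_bool /action_law /move_law /switch_law /=; ring.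
Qed.

Definition on_decoy (a y : bool) : R := y%:R.
(** A failed switch from arm 1 counts too: it restarts the memory and so begins a new sojourn. *)
Definition new_decoy (a y : bool) : R := (a && y)%:R.

(** Outcome probabilities sum to 1, so the total reward of arm 0 moves inside the expectation, where
    each round loses [Delta] on arm 1 and nothing on arm 0. *)
Lemma expected_regretE T Delta : 0 < p ->
  (forall t, (1 <= t <= T)%N -> r t arm1 = r t arm0 - Delta) ->
  expected_regret p T q r =
  Delta * \sum_x init_law p x * value on_decoy T 1 x [::].
Proof.
move=> p0 hr; have p1 : 1 + p != 0 by rewrite gt_eqF// addr_gt0.
rewrite /expected_regret /expectation.
pose c := \sum_(1 <= t < T.+1) r t arm0; rewrite -/c.
have -> : c = \sum_(w : outcome T) outcome_law p q r w * c.
  rewrite -mulr_suml -[LHS]mul1r; congr (_ * _).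
  rewrite -(pair_bigA _ (fun x (w : T.-tuple (bool * bool)) => outcome_law p q r (x, w))) /=.
  rewrite (eq_bigr (fun x => init_law p x)) => [|x _].
    by rewrite big_bool /init_law /= -mulrDl divff.
  by rewrite /outcome_law /= -mulr_sumr sum_run_law mulr1.
rewrite -sumrB mulr_sumr.
rewrite -(pair_bigA _ (fun x (w : T.-tuple (bool * bool)) =>
   outcome_law p q r (x, w) * c - outcome_law p q r (x, w) *
   \sum_(1 <= t < T.+1) r t (pulled_arm (x, w) t))) /=.
apply: eq_bigr => x _; rewrite -valueE !mulr_sumr; apply: eq_bigr => w _.
rewrite -mulrBr /outcome_law /= -sumrB.
have -> : \sum_(1 <= t < T.+1) (r t arm0 - r t (pulled_arm (x, w) t)) =
   Delta * \sum_(ay <- w) on_decoy ay.1 ay.2.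
  rewrite [in RHS](big_nth (false, false)) size_tuple mulr_sumr big_add1 /=.
  rewrite big_nat_cond [RHS]big_nat_cond; apply: eq_bigr => i /andP[/andP[_ iT] _].
  rewrite /pulled_arm /= (nth_map (false, false)) ?size_tuple //.
  rewrite /on_decoy; case: (_.2); last by rewrite mulr0 /arm0 subrr.
  by rewrite hr ?iT //= opprB addrCA subrr addr0 mulr1.
by ring.
Qed.

End Value.

(** * Upper bound: exponential switching rates *)

Section UpperBound.
Context {R : realType}.
Implicit Types (p Delta : R) (r : nat -> bool -> R) (T : nat).

(** The maximum with 0 keeps this a probability on strings of arbitrary reals. The factor 1/2 keeps
    the sum of the two transition probabilities at most 1, so the gap between the two starting arms
    never changes sign. *)
Definition softmin (K : R) (s : seq R) : R :=
  expR (- (K * Num.max 0 (last 0 s))) / 2.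

Lemma softmin_semi_markovian K : 0 <= K -> semi_markovian (softmin K).
Proof.
move=> K0 s _; have e0 := expR_gt0 (- (K * Num.max 0 (last 0 s))).
have e1 : expR (- (K * Num.max 0 (last 0 s))) <= 1.
  by rewrite expR_le1 oppr_le0 mulr_ge0 // le_max lexx.
by rewrite /softmin; apply/andP; split; lra.
Qed.

(* The player's arm is a two-state chain whose transition probabilities a_t
   (0 to 1) and p b_t (1 to 0) vary with t but keep the constant ratio
   p b_t / a_t = rho, so that all steps share one stationary law, which charges
   arm 1 with mass 1 / (1 + rho). *)
Lemma softmin_value p T r K Delta B :
  0 < p < 1 -> 0 <= K -> 1 <= B * (p * expR (- K) / 2) ->
  (forall t, (1 <= t <= T)%N ->
    Delta <= r t arm0 <= 1 /\ r t arm1 = r t arm0 - Delta) ->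
  let rho := p * expR (K * Delta) in
  forall n t, (1 <= t)%N -> (t + n <= T)%N -> 0 < Delta ->
  exists v : bool -> R,
    [/\ forall x s, s != [::] -> last 0 s = r t x ->
          value p (softmin K) r on_decoy n t.+1 x s = v x,
        v arm1 + rho * v arm0 = n%:R & 0 <= v arm1 - v arm0 <= B].
Proof.
move=> /andP[p0 p1] K0 hB hr rho; elim=> [|n IH] t t1 tnT D0.
  exists (fun=> 0); split=> //; first by rewrite mulr0 addr0.
  have c0 : 0 < p * expR (- K) / 2 by rewrite divr_gt0 ?mulr_gt0 ?expR_gt0.
  by rewrite subrr lexx -(pmulr_lge0 _ c0) (le_trans ler01).
have [||//|v [hv hM /andP[hD0 hDB]]] := IH t.+1; rewrite ?addSnnS //.
have tT : (1 <= t <= T)%N by rewrite t1 (leq_trans _ tnT) // leq_addr.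
have [/andP[r0 r1] rE] := hr t tT.
pose a := expR (- (K * r t arm0)) / 2; pose b := expR (- (K * r t arm1)) / 2.
have qE x s : last 0 s = r t x -> softmin K s = if x then b else a.
  rewrite /softmin => ->; case: x; rewrite max_r //.
    by rewrite rE subr_ge0.
  exact: le_trans (ltW D0) r0.
have a0 : 0 < a by rewrite divr_gt0 ?expR_gt0.
have a1 : a <= 1 / 2.
  rewrite ler_pM2r ?invr_gt0 // expR_le1 oppr_le0 mulr_ge0 //.
  exact: le_trans (ltW D0) r0.
have b0 : expR (- K) / 2 <= b.
  rewrite ler_pM2r ?invr_gt0 // ler_expR lerN2 ler_piMr // rE.
  by rewrite lerBlDr (le_trans r1) // lerDl ltW.
have b1 : b <= 1 / 2.
  by rewrite ler_pM2r ?invr_gt0 // expR_le1 oppr_le0 mulr_ge0 // rE subr_ge0.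
have bE : p * b = rho * a.
  rewrite /rho /a /b !mulrA; congr (_ / _); rewrite -mulrA -expRD.
  by congr (_ * expR _); rewrite rE; ring.
have pb0 : p * (expR (- K) / 2) <= p * b by rewrite ler_pM2l.
have pe0 := expR_gt0 (- K).
have pb1 : p * b <= 1 / 2 by nra.
exists (fun x => if x
  then (1 - b) * (1 + v arm1) + b * (p * v arm0 + (1 - p) * (1 + v arm1))
  else (1 - a) * v arm0 + a * (1 + v arm1)); split.
- move=> x s s0 ls; case: x ls => ls.
    rewrite value_arm1 // (qE _ _ ls) !hv ?last_rcons //; last by case: (s).
    by rewrite /on_decoy add0r.
  rewrite value_arm0 // (qE _ _ ls) !hv ?last_rcons //; last by case: (s).
  by rewrite /on_decoy add0r.
(* The weights [rho] and 1 of arms 0 and 1 are the unnormalized stationary law; the flow between the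
   arms cancels by [bE]. *)
- rewrite /= -natr1 -hM.
  transitivity (1 + v arm1 + rho * v arm0
    + (rho * a - p * b) * (1 + v arm1 - v arm0)); first by ring.
  by rewrite bE -/rho; ring.
(* The gap gains 1 and is then multiplied by [1 - a - p * b]. Since [1 <= B * (p * b)], this maps
   [[0, B]] into itself. *)
- rewrite /=.
  set d := (X in 0 <= X <= _).
  have -> : d = (1 - a - p * b) * (1 + (v arm1 - v arm0)) by rewrite /d; ring.
  set e := v arm1 - v arm0 in hD0 hDB *.
  apply/andP; split; first by rewrite mulr_ge0 //; lra.
  have c0 : 0 <= 1 - a - p * b by lra.
  apply: (@le_trans _ _ ((1 - a - p * b) * (1 + B))).
    by rewrite ler_wpM2l // lerD2l.
  have B0 : 0 <= B by apply: le_trans hDB.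
  have : B * (p * expR (- K) / 2) <= B * (p * b) by rewrite ler_wpM2l // -mulrA.
  by nra.
Qed.

(** The three terms bound round 1, the value from arm 0 (the stationary cost), and the gap between
    the two starting arms (the transient). *)
Lemma softmin_regret p T r K : (0 < T)%N -> 0 < p < 1 -> 0 < K ->
  consistent_adversary T r ->
  expected_regret p T (softmin K) r <= 1 + T%:R / (p * K) + 2 * expR K / p.
Proof.
case: T => // n _ hp K0 [Delta /andP[D0 D1] hr]; have /andP[p0 p1] := hp.
rewrite (@expected_regretE _ _ _ _ _ Delta) // => [|t /hr[]//].
pose rho := p * expR (K * Delta); pose B := 2 * expR K / p.
have hB : 1 <= B * (p * expR (- K) / 2).
  rewrite /B expRN; have e0 := expR_gt0 K.
  by rewrite [leRHS](_ : _ = 1) //; field; rewrite !gt_eqF.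
have [v [hv hM /andP[h0 hB']]] := softmin_value _ _ _ _ _ _ hp (ltW K0) hB hr n 1 (leqnn 1) (leqnn _) D0.
rewrite big_bool !value_nil !hv // /on_decoy add0r.
have rho0 : 0 < rho by rewrite mulr_gt0 ?expR_gt0.
have v0 : rho * v arm0 <= n%:R / 1 - v arm0 by rewrite divr1 -hM -/rho; lra.
(* As [rho] is at least [p * K * Delta], the offset cancels and the bound is uniform over
   adversaries. *)
have v0' : Delta * v arm0 <= n%:R / (p * K).
  have [v00|v00] := leP (v arm0) 0.
    by rewrite (@le_trans _ _ 0) ?mulr_ge0_le0 ?divr_ge0 ?(ltW D0) // ltW // mulr_gt0.
  rewrite ler_pdivlMr ?mulr_gt0 //.
  have := expR_ge1Dx (K * Delta) => he.
  have : p * (K * Delta) * v arm0 <= rho * v arm0.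
    rewrite ler_wpM2r ?(ltW v00) // /rho ler_wpM2l ?(ltW p0) //.
    by apply: le_trans he; rewrite lerDr.
  by nra.
rewrite [X in Delta * X](_ : _ =
   v arm0 + (1 / (1 + p)) * (1 + (v arm1 - v arm0))); last first.
  by rewrite /init_law /arm0 /arm1 /=; field; rewrite gt_eqF //; lra.
have i1 : 1 / (1 + p) <= 1 by rewrite ler_pdivrMr; lra.
have i0 : 0 < 1 / (1 + p) by rewrite divr_gt0; lra.
have h1 : Delta * (1 / (1 + p) * (1 + (v arm1 - v arm0))) <= 1 + B.
  set z := v arm1 - v arm0 in h0 hB' *.
  have : Delta * (1 / (1 + p)) <= 1 by nra.
  have : 0 < Delta * (1 / (1 + p)) by rewrite mulr_gt0.
  by rewrite mulrA; nra.
have : n%:R / (p * K) <= n.+1%:R / (p * K).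
  by rewrite ler_pM2r ?invr_gt0 ?mulr_gt0 // ler_nat.
by rewrite mulrDr -/B; lra.
Qed.

End UpperBound.

(** * Lower bound: sojourns under constant rewards *)

Lemma ler_mix {R : realDomainType} (z c x y : R) :
  0 <= z <= 1 -> c <= x -> c <= y -> c <= (1 - z) * x + z * y.
Proof. by move=> /andP[? ?] ? ?; nra. Qed.

Lemma rcons_nseq {A : Type} n (v : A) : rcons (nseq n v) v = nseq n.+1 v.
Proof. by elim: n => //= n ->. Qed.

Section LowerBound.
Context {R : realType}.
Variables (p : R) (q : seq R -> R).
Hypotheses (p01 : 0 < p < 1) (q01 : semi_markovian q).

(* Expected number of rounds, among the next n, before the first switch request
   of a player who has just seen the reward v for k rounds and keeps seeing it. *)
Fixpoint residual v k n : R :=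
  if n is n'.+1 then (1 - q (nseq k v)) * (1 + residual v k.+1 n') else 0.

Let q_bounds v k : 0 <= q (nseq k.+1 v) <= 1.
Proof. exact: q01. Qed.

Lemma residual_ge0 v k n : 0 <= residual v k.+1 n.
Proof.
elim: n k => //= n IH k; have /andP[_ h] := q_bounds v k.
by rewrite mulr_ge0 ?subr_ge0 // addr_ge0.
Qed.

Lemma residual_le v k n : residual v k.+1 n <= n%:R.
Proof.
elim: n k => //= n IH k; have /andP[h0 h1] := q_bounds v k.
have := IH k.+1; have := residual_ge0 v k.+1 n; rewrite -natr1; nra.
Qed.

Lemma residual_mono v k m n : (m <= n)%N -> residual v k.+1 m <= residual v k.+1 n.
Proof.
elim: m n k => [|m IH] [|n] k // mn; first exact: residual_ge0.
have /andP[_ h] := q_bounds v k.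
by rewrite /= ler_wpM2l ?subr_ge0 // lerD2l IH.
Qed.

Section ConstantRewards.
Variables (u : bool -> R).
Let r (t : nat) y := u y.
Let decoy_time := value p q r (@on_decoy R).
Let decoy_visits := value p q r (@new_decoy R).

(** Under constant rewards the memory is always a repetition of [u x], so the arm and the length
    describe the whole state. *)
Lemma value_ge0 g n t x k : (forall a y, 0 <= g a y) ->
  0 <= value p q r g n t x (nseq k.+1 (u x)).
Proof.
move=> g0; elim: n t x k => [|n IH] t x k; first exact: lexx.
have /andP[p0 p1] := p01; have /andP[h0 h1] := q_bounds (u x) k.
have st y : 0 <= value p q r g n t.+1 y [:: u y] by exact: (IH t.+1 y 0%N).
case: x h0 h1 => h0 h1; rewrite ?value_arm1 ?value_arm0 // !rcons_nseq;
  by rewrite !(subr_ge0, addr_ge0, mulr_ge0) ?(ltW p0) ?(ltW p1) ?IH.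
Qed.

Lemma value_mono g m n t x k : (forall a y, 0 <= g a y) -> (m <= n)%N ->
  value p q r g m t x (nseq k.+1 (u x)) <= value p q r g n t x (nseq k.+1 (u x)).
Proof.
move=> g0; elim: m n t x k => [|m IH] [|n] t x k // mn; first exact: value_ge0.
have /andP[p0 p1] := p01; have /andP[h0 h1] := q_bounds (u x) k.
have st y : value p q r g m t.+1 y [:: u y] <= value p q r g n t.+1 y [:: u y].
  exact: (IH n t.+1 y 0%N).
case: x h0 h1 => h0 h1; rewrite ?value_arm1 ?value_arm0 // !rcons_nseq;
  by rewrite !(lerD, ler_wpM2l) ?subr_ge0 ?lerD2l ?(ltW p0) ?(ltW p1) ?IH.
Qed.

(* Rounds on arm 0 are paid for by the sojourns there, each of expected length
   at most 1 + residual, and every such sojourn beyond the current one follows a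
   sojourn on arm 1. *)
Lemma rounds_le m n t x k : (n <= m.+1)%N ->
  n%:R <= decoy_time n t x (nseq k.+1 (u x))
    + (~~ x)%:R * residual (u arm0) k.+1 n
    + (1 + residual (u arm0) 1 m) * (decoy_visits n t x (nseq k.+1 (u x)) + x%:R).
Proof.
rewrite /decoy_time /decoy_visits.
set H := 1 + _.
have H1 : 1 <= H by rewrite lerDl residual_ge0.
elim: n t x k => [|n IH] t x k nm.
  by rewrite /= mulr0 !add0r mulr_ge0 ?ler0n // (le_trans ler01 H1).
have /andP[p0 p1] := p01; have /andP[h0 h1] := q_bounds (u x) k.
have hn := ltnW nm.
(* The credit [H] held while on arm 1 pays for the sojourn that a successful switch opens on arm 0;
   at most [m] rounds remain for it. *)
have hG : 1 + residual (u arm0) 1 n <= H by rewrite lerD2l residual_mono.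
have I0 := IH t.+1 false 0%N hn; have I1 := IH t.+1 true 0%N hn.
have Is := IH t.+1 x k.+1 hn.
case: x h0 h1 Is => h0 h1 Is; rewrite ?value_arm1 ?value_arm0 // !rcons_nseq;
  rewrite /= /on_decoy /new_decoy /= -natr1.
- rewrite /= !mul0r !mul1r !addr0 in I0 I1 Is *.
  set N1 := value _ _ _ _ _ _ true [:: _] in I1 *.
  set N0 := value _ _ _ _ _ _ false [:: _] in I0 *.
  set N2 := value _ _ _ _ _ _ true (_ :: _ :: _) in Is *.
  set S1 := value _ _ _ _ _ _ true [:: _] in I1 *.
  set S0 := value _ _ _ _ _ _ false [:: _] in I0 *.
  set S2 := value _ _ _ _ _ _ true (_ :: _ :: _) in Is *.
  set z := q _ in h0 h1 *.
  rewrite [leRHS](_ : _ = (1 - z) * (1 + N2 + H * (S2 + 1)) +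
    z * ((1 - p) * (1 + N1 + H * (S1 + 1) + H) + p * (N0 + H * (S0 + 1))));
    last by ring.
  apply: ler_mix; [by apply/andP | lra | apply: ler_mix].
  - by rewrite (ltW p0) (ltW p1).
  - lra.
  - lra.
- rewrite /= !mul0r !mul1r !addr0 in I0 I1 Is *.
  set N1 := value _ _ _ _ _ _ true [:: _] in I1 *.
  set N2 := value _ _ _ _ _ _ false (_ :: _ :: _) in Is *.
  set S1 := value _ _ _ _ _ _ true [:: _] in I1 *.
  set S2 := value _ _ _ _ _ _ false (_ :: _ :: _) in Is *.
  set z := q _ in h0 h1 *.
  set G := residual _ _ _ in Is *.
  rewrite [leRHS](_ : _ = (1 - z) * (1 + G + N2 + H * S2) +
    z * (1 + N1 + H * (S1 + 1))); last by ring.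
  by apply: ler_mix; [apply/andP | lra | lra].
Qed.

(** Visits are counted over [n] rounds but time over [n + m]: each counted sojourn has at least [m]
    rounds left after its first one, so truncation does not shorten it below
    [1 + residual (u arm1) 1 m] on average. *)
Lemma decoy_time_ge m n t (x : bool) k :
  x%:R * residual (u arm1) k.+1 (n + m)
    + (1 + residual (u arm1) 1 m) * decoy_visits n t x (nseq k.+1 (u x))
  <= decoy_time (n + m) t x (nseq k.+1 (u x)).
Proof.
rewrite /decoy_time /decoy_visits /arm1.
set H := 1 + _.
have H1 : 1 <= H by rewrite lerDl residual_ge0.
elim: n t x k => [|n IH] t x k.
  (* No visit is left to count: only the current sojourn is kept, and time after the next switch
     request is dropped. *)
  rewrite [value _ _ _ _ 0 _ _ _]/= mulr0 addr0 add0n {H H1}.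
  elim: m t x k => [|m IH] t x k; first by rewrite mulr0.
  have /andP[p0 p1] := p01; have /andP[h0 h1] := q_bounds (u x) k.
  have st y : 0 <= value p q r (@on_decoy R) m t.+1 y [:: u y].
    by apply: (value_ge0 _ _ _ _ 0%N) => a b; exact: ler0n.
  case: x h0 h1 => h0 h1; last first.
    by rewrite mul0r value_ge0 // => a b; exact: ler0n.
  have := IH t.+1 true k.+1; rewrite !mul1r => Is.
  rewrite value_arm1 // rcons_nseq /= /on_decoy add0r.
  by rewrite ler_wpDr ?ler_wpM2l ?subr_ge0 ?lerD2l // mulr_ge0 // addr_ge0 //
     mulr_ge0 ?(ltW p0) ?subr_ge0 ?(ltW p1) // addr_ge0.
have /andP[p0 p1] := p01; have /andP[h0 h1] := q_bounds (u x) k.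
have I0 := IH t.+1 false 0%N; have I1 := IH t.+1 true 0%N.
have Is := IH t.+1 x k.+1.
have hG : H <= 1 + residual (u true) 1 (n + m).
  by rewrite lerD2l residual_mono // leq_addl.
rewrite addSn -subr_ge0.
case: x h0 h1 Is => h0 h1 Is; rewrite ?value_arm1 ?value_arm0 // !rcons_nseq;
  rewrite /= /on_decoy /new_decoy /=;
  rewrite /= !mul0r !mul1r ?add0r ?addr0 in I0 I1 Is *.
- set S1 := value _ _ _ _ _ _ true [:: _] in I1 *.
  set S0 := value _ _ _ _ _ _ false [:: _] in I0 *.
  set S2 := value _ _ _ _ _ _ true (_ :: _ :: _) in Is *.
  set N1 := value _ _ _ _ _ _ true [:: _] in I1 *.
  set N0 := value _ _ _ _ _ _ false [:: _] in I0 *.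
  set N2 := value _ _ _ _ _ _ true (_ :: _ :: _) in Is *.
  set z := q _ in h0 h1 *.
  set G := residual _ _.+2 _ in Is *.
  rewrite [leRHS](_ : _ = (1 - z) * (N2 - G - H * S2) +
    z * ((1 - p) * (1 + N1 - H * (1 + S1)) + p * (N0 - H * S0))); last by ring.
  apply: ler_mix; [by apply/andP | lra | apply: ler_mix].
  - by rewrite (ltW p0) (ltW p1).
  - lra.
  - lra.
- set S1 := value _ _ _ _ _ _ true [:: _] in I1 *.
  set S2 := value _ _ _ _ _ _ false (_ :: _ :: _) in Is *.
  set N1 := value _ _ _ _ _ _ true [:: _] in I1 *.
  set N2 := value _ _ _ _ _ _ false (_ :: _ :: _) in Is *.
  set z := q _ in h0 h1 *.
  rewrite [leRHS](_ : _ = (1 - z) * (N2 - H * S2) +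
    z * (1 + N1 - H * (1 + S1))); last by ring.
  by apply: ler_mix; [apply/andP | lra | lra].
Qed.

(** Counting the initial sojourn, the arm 0 share in [rounds_le] is at most twice the time on arm 1
    by the ratio hypothesis; with the time on arm 1 itself this gives the factor 3. *)
Lemma constant_rewards_decoy_time m n : (n <= m.+1)%N ->
  1 + residual (u arm0) 1 m <= 2 * (1 + residual (u arm1) 1 m) ->
  n.+1%:R <= 3 * value p q r (@on_decoy R) (n + m).+1 1 arm1 [::].
Proof.
move=> nm h2; rewrite value_nil {1}/on_decoy.
have := rounds_le m n 2 true 0%N nm; rewrite mul0r addr0 => hA.
have := decoy_time_ge m n 2 true 0%N; rewrite mul1r => hB.
have /= hM := @value_mono (@on_decoy R) n (n + m) 2 true 0%N
  (fun a b => ler0n _ _) (leq_addr _ _).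
have hG : residual (u arm1) 1 m <= residual (u arm1) 1 (n + m).
  by rewrite residual_mono // leq_addl.
rewrite /decoy_time /decoy_visits /r /= in hA hB hM *.
have S0 : 0 <= value p q (fun _ y => u y) (@new_decoy R) n 2 true [:: u true].
  by apply: (value_ge0 _ _ _ _ 0%N) => a b; exact: ler0n.
set S := value _ _ _ (@new_decoy R) _ _ _ _ in hA hB hM S0 *.
set N := value _ _ _ _ n _ _ _ in hA hM *.
set N' := value _ _ _ _ _ _ _ _ in hB hM *.
have h3 : (1 + residual (u arm0) 1 m) * (S + 1) <=
  2 * (1 + residual (u arm1) 1 m) * (S + 1) by rewrite ler_wpM2r // addr_ge0.
rewrite mulrDr mulr1 in hA h3; rewrite mulrDr mulr1 -mulrA mulrDl mul1r in h3.
rewrite -natr1; lra.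
Qed.

End ConstantRewards.
End LowerBound.

(** * Choice of the adversary and of the constants *)

Lemma exists_slow_step {R : realDomainType} (h : nat -> R) M :
  1 <= h 0%N -> h M < 2 ^+ M -> exists2 i, (i < M)%N & h i.+1 <= 2 * h i.
Proof.
move=> h0; elim: M => [|M IH] hM; first by rewrite expr0 ltNge h0 in hM.
have [hle|hlt] := leP (h M.+1) (2 * h M); first by exists M.
have [|i iM hi] := IH; last by exists i; rewrite // ltnS ltnW.
by rewrite -(ltr_pM2l (ltr0n R 2)) -exprS (lt_trans hlt).
Qed.

(** The 12 is 2 * 3 * 2: the player starts on arm 1 with probability at least 1/2, then spends there
    at least a third of [n.+1] rounds, and [n.+1] is at least half of [T]. *)
Lemma semi_markovian_regret_ge {R : realType} (p : R) (q : seq R -> R) T M :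
  0 < p < 1 -> semi_markovian q -> (0 < T)%N -> (0 < M)%N -> (T < 2 ^ M)%N ->
  exists2 r, consistent_adversary T r &
    T%:R / (12 * M%:R) <= expected_regret p T q r.
Proof.
move=> hp hq T0 M0 TM; have /andP[p0 p1] := hp.
(* Round 1 is set apart; visits are counted in the first half of the rest, and the second half
   leaves their sojourns room to run. *)
pose n := T.-1./2; pose m := (T.-1 - n)%N.
have nm : (n <= m)%N.
  by rewrite /m leq_subRL ?addnn -[leqRHS]odd_double_half ?leq_addl // -addnn addnA leq_addl.
have TE : T = (n + m).+1.
  by rewrite /m subnKC ?prednK // (leq_trans nm) // leq_subr.
have hn : (T <= 2 * n.+1)%N.
  by rewrite -(prednK T0) -[T.-1]odd_double_half -/n mul2n doubleS ltnS -addn1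
    -[_.+1]addn1 addnC leq_add2l; case: odd.
have MR : 0 < M%:R :> R by rewrite ltr0n.
pose h i := 1 + residual q (i%:R / M%:R) 1 m.
have [||i iM hi] := exists_slow_step h M.
- by rewrite lerDl residual_ge0.
- rewrite (@le_lt_trans _ _ T%:R) // /h.
    by rewrite TE -natr1 addrC lerD2r (le_trans (residual_le _ hq _ _ _)) //
      ler_nat leq_addl.
  by rewrite -natrX ltr_nat.
pose u (y : bool) : R := (if y then i else i.+1)%:R / M%:R.
have V := constant_rewards_decoy_time p q hp hq u m n (leqW nm) hi.
have V0 : 0 <= value p q (fun _ => u) (@on_decoy R) T 1 false [::].
  rewrite TE value_nil add0r.
  by apply: (value_ge0 p q hp hq u _ _ _ _ 0%N) => a b; exact: ler0n.
exists (fun _ => u).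
  exists M%:R^-1; first by rewrite invr_gt0 MR invf_le1 // ler1n.
  move=> t _; rewrite /u /=; split.
    by rewrite -[leLHS]mul1r ler_pM2r ?invr_gt0 // ler1n /= ler_pdivrMr // mul1r ler_nat.
  by rewrite -natr1 mulrDl mul1r addrK.
rewrite (@expected_regretE _ _ _ _ _ M%:R^-1) // => [|t _]; last first.
  by rewrite /u /= -natr1 mulrDl mul1r addrK.
rewrite -TE in V.
rewrite invfM [12^-1 * _]mulrC mulrCA ler_pM2l ?invr_gt0 //.
rewrite big_bool /init_law /=.
set V1 := value _ _ _ _ _ _ true _ in V *.
have i1 : 1 / 2 <= 1 / (1 + p) by rewrite !mul1r lef_pV2 ?posrE; lra.
have i0 : 0 <= p / (1 + p) by rewrite divr_ge0; lra.
have hT : T%:R <= 2 * n.+1%:R :> R by rewrite -natrM ler_nat.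
have n0 : 0 <= n.+1%:R :> R by [].
have : 1 / 2 * V1 <= 1 / (1 + p) * V1 by rewrite ler_wpM2r //; lra.
have := mulr_ge0 i0 V0.
lra.
Qed.

Theorem theorem7 (R : realType) (p : R) (hp : 0 < p < 1) :
  exists (C c : R) (T0 : nat),
    [/\ 0 < C, 0 < c & (0 < T0)%N] /\
    forall T : nat, (T0 <= T)%N ->
      (exists2 q : seq R -> R, semi_markovian q &
         forall r : nat -> bool -> R, consistent_adversary T r ->
           expected_regret p T q r <= C * (T%:R / ln T%:R)) /\
      (forall q : seq R -> R, semi_markovian q ->
         exists2 r : nat -> bool -> R, consistent_adversary T r &
           c * (T%:R / ln T%:R) <= expected_regret p T q r).
Proof.
have /andP[p0 p1] := hp.
have l2 : 0 < ln 2 :> R by rewrite ln_gt0 // ltr1n.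
(* The first constant adds 1, 2 / p and 4 / p from [e1], [e3] and [e4]; the second divides the 1/12
   of [semi_markovian_regret_ge] by the 2 / ln 2 of [hM]. *)
exists (1 + 6 / p), (ln 2 / 24), 2%N; split.
  by split; rewrite // ?divr_gt0 // addr_gt0 // divr_gt0.
move=> T T2; have T0 : (0 < T)%N by exact: ltnW.
have TR : 0 < T%:R :> R by rewrite ltr0n.
have lT : ln 2 <= ln T%:R :> R by rewrite ler_ln ?posrE // ler_nat.
have lT0 : 0 < ln T%:R :> R by exact: lt_le_trans lT.
split.
  pose K : R := ln T%:R / 2.
  have K0 : 0 < K by rewrite divr_gt0.
  exists (softmin K); first exact/softmin_semi_markovian/ltW.
  move=> r hr; apply: le_trans (softmin_regret _ _ _ _ T0 hp K0 hr) _.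
  have lE : ln T%:R = 2 * K by rewrite /K; field.
  have TE : T%:R = expR K ^+ 2 by rewrite -expRM_natl -lE lnK // posrE.
  have eK := expR_ge1Dx K.
  have e1 : 1 <= T%:R / ln T%:R :> R by rewrite ler_pdivlMr // lE TE; nra.
  have e2 : expR K <= 2 * (T%:R / ln T%:R).
    rewrite mulrA ler_pdivlMr // lE TE expr2; have := expR_gt0 K; nra.
  have e3 : T%:R / (p * K) = 2 / p * (T%:R / ln T%:R).
    by rewrite lE; field; rewrite !gt_eqF.
  have e4 : 2 * expR K / p <= 4 / p * (T%:R / ln T%:R).
    by rewrite [leRHS]mulrAC ler_pM2r ?invr_gt0 //; lra.
  by rewrite e3; lra.
move=> q hq; pose M := (trunc_log 2 T).+1.
have [//|//||r hr hreg] := semi_markovian_regret_ge p q T M hp hq.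
  exact: trunc_log_ltn.
exists r => //; apply: le_trans hreg.
have MR : 0 < M%:R :> R by rewrite ltr0n.
(* The successor in [M] costs one more [ln 2], which is at most [ln T%:R] because [T] is at least
   2. *)
have hM : M%:R * ln 2 <= 2 * ln T%:R :> R.
  have : (trunc_log 2 T)%:R * ln 2 <= ln T%:R :> R.
    rewrite mulr_natl -lnXn // ler_ln ?posrE ?exprn_gt0 // -natrX ler_nat.
    exact: trunc_logP.
  by rewrite /M -natr1; lra.
rewrite mulrCA ler_pM2l // -[leRHS]div1r ler_pdivlMr ?mulr_gt0 // mulrAC ler_pdivrMr //; lra.
Qed.
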